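(* Let $n\ge 2$, $d\ge 1$, $\tau>0$, $\sigma>0$. Let $\mu^\star_1,\mu^\star_2\stackrel{\mathrm{i.i.d.}}{\sim}\mathcal N(0,\tau^2 I_d)$ and $\xi_1,\dots,\xi_n\stackrel{\mathrm{i.i.d.}}{\sim}\mathcal N(0,\sigma^2 I_d)$, independent, let $z^\star_1,\dots,z^\star_n\in\{1,2\}$ be fixed labels with both classes $S^\star_\ell=\{i:z^\star_i=\ell\}$ nonempty, and $x_i=\mu^\star_{z^\star_i}+\xi_i$. Let $\{C_1,C_2\}$ be a fixed partition of $[n]$ into two nonempty sets. Fix $i\in[n]$, let $\ell$ with $i\in S^\star_\ell$, $j$ with $i\in C_j$, and $\overline j$ the other cluster index. If $$0<R^\ell_j\le R^\ell_{\overline j}\le 1,$$ then $$\mathbb P\bigl(\Delta_H^2(x_i,C_j)\le\Delta_H^2(x_i,C_{\overline j})\bigr)\le\rho^{d/4},$$ where $$\rho=1-\left(\frac{\tau^2\Bigl(\frac{|C_j|}{|C_j|-1}(1-R^\ell_j)^2-\frac{|C_{\overline j}|}{|C_{\overline j}|+1}(1-R^\ell_{\overline j})^2\Bigr)}{\tau^2\Bigl(\frac{|C_j|}{|C_j|-1}(1-R^\ell_j)^2+\frac{|C_{\overline j}|}{|C_{\overline j}|+1}(1-R^\ell_{\overline j})^2\Bigr)+\sigma^2}\right)^2,$$ and $0\le\rho<1$.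
   Context: $R^\ell_k=|C_k\cap S^\star_\ell|/|C_k|$ (purity). Centroids $\widehat\mu_k=|C_k|^{-1}\sum_{m\in C_k}x_m$. The Hartigan weighted distance is $\Delta_H^2(x_i,C_k)=\frac{|C_k|}{|C_k|-1}\|x_i-\widehat\mu_k\|^2$ if $i\in C_k$ and $\Delta_H^2(x_i,C_k)=\frac{|C_k|}{|C_k|+1}\|x_i-\widehat\mu_k\|^2$ if $i\notin C_k$. Randomness is only over the centers and noise. *)

(* Defs.v *)
From HB Require Import structures.
From mathcomp Require Import all_boot all_order all_algebra.
From mathcomp Require Import all_classical all_reals all_analysis.
Set Implicit Arguments. Unset Strict Implicit. Unset Printing Implicit Defensive.
Import Order.TTheory GRing.Theory Num.Theory.
Local Open Scope classical_set_scope.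
Local Open Scope ring_scope.

(* Mutual independence of a finite family of real random variables:
   each is measurable and, for every family of Borel sets, the probability
   of the joint event is the product of the marginal probabilities
   (subfamilies are obtained by taking B k = setT). *)
Definition mutually_independent {dT : measure_display} {T : measurableType dT}
  {R : realType} (P : probability T R) (I : finType) (X : I -> T -> R) : Prop :=
  (forall k, measurable_fun [set: T] (X k)) /\
  forall B : I -> set R, (forall k, measurable (B k)) ->
    P (\bigcap_(k in [set: I]) (X k @^-1` B k)) =
    (\prod_(k : I) P (X k @^-1` B k))%E.

(* X has law N(m, s^2) (s = standard deviation). *)
Definition has_normal_law {dT : measure_display} {T : measurableType dT}
  {R : realType} (P : probability T R) (X : T -> R) (m s : R) : Prop :=
  forall B : set R, measurable B -> P (X @^-1` B) = normal_prob m s B.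

Definition other (j : 'I_2) : 'I_2 := inord (1 - j).

Definition lblset {n : nat} (lab : 'I_n -> 'I_2) (k : 'I_2) : {set 'I_n} :=
  [set m | lab m == k].

Definition purity {R : realType} {n : nat} (z c : 'I_n -> 'I_2) (l k : 'I_2) : R :=
  (#|lblset c k :&: lblset z l|)%:R / (#|lblset c k|)%:R.

Definition sqdist {R : realType} {d : nat} (u v : 'I_d -> R) : R :=
  \sum_(t < d) (u t - v t) ^+ 2.

Definition centroid {R : realType} {n d : nat} (c : 'I_n -> 'I_2)
  (x : 'I_n -> 'I_d -> R) (k : 'I_2) : 'I_d -> R :=
  fun t => (#|lblset c k|)%:R^-1 * \sum_(m in lblset c k) x m t.

Definition hartigan {R : realType} {n d : nat} (c : 'I_n -> 'I_2)
  (x : 'I_n -> 'I_d -> R) (i : 'I_n) (k : 'I_2) : R :=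
  let N := (#|lblset c k|)%:R in
  (if c i == k then N / (N - 1) else N / (N + 1)) *
  sqdist (x i) (centroid c x k).

(* Main.v *)
(* Let U and V be the Hartigan distances from x_i to its own and to the other
   cluster. Each is a sum over the d coordinates of squares of independent
   centered Gaussian variables: the cluster weight |C|/(|C| -+ 1) makes the
   noise variance exactly sigma^2, so that the coordinate variances are
   A = 2 tau^2 a + sigma^2 for U and B = 2 tau^2 b + sigma^2 for V. The Chernoff
   bound P(U <= V) <= E exp(theta (V - U) / 2) and the Cauchy-Schwarz inequality
   decouple U from V, leaving ((1 - 2 theta B)(1 + 2 theta A))^(-d/4), which is
   rho^(d/4) at the optimal theta.

   The transform y |-> E exp(lam (y + Y)^2) identifies Gaussian laws well enough:
   it is computed from the normal density and is stable under adding an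
   independent variable, so no convolution of laws is needed. *)

Require Import Defs.
From HB Require Import structures.
From mathcomp Require Import all_boot all_order all_algebra.
From mathcomp Require Import all_classical all_reals all_analysis.
From mathcomp Require Import measurable_realfun ring lra.
Import Order.TTheory GRing.Theory Num.Theory.
Local Open Scope classical_set_scope.
Local Open Scope ring_scope.

(** * Independence of pairs of variables and of blocks of a family *)

Definition independent2 {dT : measure_display} {T : measurableType dT}
  {R : realType} (P : probability T R) (Y Z : T -> R) : Prop :=
  [/\ measurable_fun [set: T] Y, measurable_fun [set: T] Z &
    forall A B : set R, measurable A -> measurable B ->
      P (Y @^-1` A `&` Z @^-1` B) = (P (Y @^-1` A) * P (Z @^-1` B))%E].

Lemma measurable_preimage {dT : measure_display} {T : measurableType dT}
    {d' : measure_display} {T' : measurableType d'} (f : T -> T') (A : set T') :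
  measurable_fun [set: T] f -> measurable A -> measurable (f @^-1` A).
Proof. by move=> mf mA; rewrite -[X in measurable X]setTI; exact: mf. Qed.

(** Rectangles determine a measure on the plane: both sides, as functions of [D], agree on
    rectangles with one product measure, so uniqueness of the product extends the factorization to
    all Borel sets. This is what lets [Y] and [Z] be merged by an operation while staying
    independent of [E]. *)
Lemma independent2_event {dT : measure_display} {T : measurableType dT}
    {R : realType} (P : probability T R) (Y Z : T -> R) (E : set T) :
  independent2 P Y Z -> measurable E ->
  (forall A B : set R, measurable A -> measurable B ->
     P ((Y @^-1` A `&` Z @^-1` B) `&` E) =
     (P (Y @^-1` A) * P (Z @^-1` B) * P E)%E) ->
  forall D : set (R * R), measurable D ->
    P ((fun w => (Y w, Z w)) @^-1` D `&` E) =
    (P ((fun w => (Y w, Z w)) @^-1` D) * P E)%E.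
Proof.
move=> [mY mZ indYZ] mE indE D mD.
have mYZ : measurable_fun [set: T] (fun w => (Y w, Z w)).
  exact: measurable_fun_pair.
pose Y' : {mfun T >-> R} := HB.pack Y (isMeasurableFun.Build _ _ _ _ Y mY).
pose Z' : {mfun T >-> R} := HB.pack Z (isMeasurableFun.Build _ _ _ _ Z mZ).
pose YZ : {mfun T >-> (R * R)%type} :=
  HB.pack (fun w => (Y w, Z w)) (isMeasurableFun.Build _ _ _ _ _ mYZ).
have PE : P E \is a fin_num by exact: fin_num_measure.
have PE0 : (0 <= fine (P E))%R by exact: fine_ge0.
pose m1 : {sigma_finite_measure set R -> \bar R} := distribution P Y'.
(* The constant [P E] is absorbed into the second factor, so that both sides are compared with the
   same product [m1 \x m2]. *)
pose m2 : {sigma_finite_measure set R -> \bar R} :=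
  mscale (NngNum PE0) (distribution P Z').
pose Q1 : {measure set (R * R) -> \bar R} := pushforward (mrestr P mE) YZ.
pose Q2 : {measure set (R * R) -> \bar R} :=
  mscale (NngNum PE0) (distribution P YZ).
transitivity ((m1 \x m2)%E D).
  apply/esym; apply: (@product_measure_unique _ _ _ _ _ m1 m2 (Q1 mYZ) _ D mD).
  move=> A B mA mB.
  change (P ((Y @^-1` A `&` Z @^-1` B) `&` E) =
    P (Y @^-1` A) * ((fine (P E))%:E * P (Z @^-1` B)))%E.
  by rewrite indE// fineK// -muleA [(P E * _)%E]muleC.
rewrite (@product_measure_unique _ _ _ _ _ m1 m2 Q2)//; last first.
  move=> A B mA mB.
  change ((fine (P E))%:E * P (Y @^-1` A `&` Z @^-1` B) =
    P (Y @^-1` A) * ((fine (P E))%:E * P (Z @^-1` B)))%E.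
  by rewrite (indYZ A B)// muleCA.
change ((fine (P E))%:E * P (YZ @^-1` D) = P (YZ @^-1` D) * P E)%E.
by rewrite fineK// muleC.
Qed.

(** Independence makes the joint law the product of the marginal laws; Tonelli then integrates [Y]
    first, with [Z] frozen. *)
Lemma ge0_integral_independent2 {dT : measure_display} {T : measurableType dT}
    {R : realType} (P : probability T R) (Y Z : T -> R) (f : R * R -> R) :
  independent2 P Y Z -> measurable_fun setT f -> (forall u, 0 <= f u) ->
  (\int[P]_w (f (Y w, Z w))%:E = \int[P]_w \int[P]_w' (f (Y w', Z w))%:E)%E.
Proof.
move=> [mY mZ indYZ] mf f0.
have mYZ : measurable_fun [set: T] (fun w => (Y w, Z w)).
  exact: measurable_fun_pair.
pose Y' : {mfun T >-> R} := HB.pack Y (isMeasurableFun.Build _ _ _ _ Y mY).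
pose Z' : {mfun T >-> R} := HB.pack Z (isMeasurableFun.Build _ _ _ _ Z mZ).
pose YZ : {mfun T >-> (R * R)%type} :=
  HB.pack (fun w => (Y w, Z w)) (isMeasurableFun.Build _ _ _ _ _ mYZ).
have mEf : measurable_fun setT (EFin \o f) by exact/measurable_EFinP.
have Ef0 u : (0 <= (EFin \o f) u)%E by rewrite lee_fin.
transitivity (\int[distribution P YZ]_u (EFin \o f) u)%E.
  by rewrite ge0_integral_distribution.
transitivity (\int[(distribution P Y' \x distribution P Z')%E]_u (EFin \o f) u)%E.
  apply: eq_measure_integral => D mD _; apply/esym.
  by apply: product_measure_unique => // A B mA mB; exact: indYZ.
rewrite fubini_tonelli2// ge0_integral_distribution//=.
- apply: eq_integral => w _; rewrite /fubini_G ge0_integral_distribution//=.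
    exact/measurable_EFinP/measurableT_comp.
  by move=> y; rewrite lee_fin.
- by apply: (measurable_fun_fubini_tonelli_G (m1 := distribution P Y')).
- by move=> y; apply: integral_ge0 => x _; exact: Ef0.
Qed.

(* [K Y u] records a numerical invariant [u] of the law of [Y] that composes
   along [op] for independent variables. *)
Section grouping.
Context {dT : measure_display} {T : measurableType dT} {R : realType}.
Variables (P : probability T R) (I J : finType) (X : I -> T -> R) (p : I -> J).
Variables (op : R -> R -> R) (e : R) (op' : R -> R -> R) (e' : R).
Variables (K : (T -> R) -> R -> Prop) (v : I -> R).
Hypothesis mop : measurable_fun setT (fun u : R * R => op u.1 u.2).
Hypothesis Ke : K (cst e) e'.
Hypothesis KX : forall k, K (X k) (v k).
Hypothesis Kop : forall Y Z y z, independent2 P Y Z -> K Y y -> K Z z ->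
  K (fun w => op (Y w) (Z w)) (op' y z).

Let Z (s : seq I) (j : J) (w : T) : R := \big[op/e]_(k <- s | p k == j) X k w.

(** Indices in [s] have already been absorbed into blocks, the others are still free; such an event
    constrains both kinds at once. *)
Let event (s : seq I) (B : J -> set R) (D : I -> set R) : set T :=
  [set w | (forall j, B j (Z s j w)) /\ forall k, k \notin s -> D k (X k w)].

(** The invariant of an induction on [s]: for empty [s] it amounts to independence of the [X k], for
    a full enumeration to independence of the blocks. *)
Let good (s : seq I) : Prop :=
  [/\ forall j, measurable_fun [set: T] (Z s j),
      forall j, K (Z s j) (\big[op'/e']_(k <- s | p k == j) v k) &
      forall B D, (forall j, measurable (B j)) -> (forall k, measurable (D k)) ->
        P (event s B D) = ((\prod_j P (Z s j @^-1` B j)) *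
          \prod_(k | k \notin s) P (X k @^-1` D k))%E].

Let forall_measurable (F : finType) (Y : F -> T -> R) (C : F -> set R)
    (Q : pred F) :
  (forall k, measurable_fun [set: T] (Y k)) -> (forall k, measurable (C k)) ->
  measurable [set w | forall k, Q k -> C k (Y k w)].
Proof.
move=> mY mC; apply: (@fin_bigcap_measurable _ _ _ (fun k => Q k)
  (fun k => Y k @^-1` C k)) => [|k _]; first exact: finite_finset.
exact: measurable_preimage.
Qed.

Let PsetT : P (setT : set T) = 1%E. Proof. exact: probability_setT. Qed.

(** Absorbing [k0] changes only the block [p k0]. The free variable [X k0], that partial block and
    the event [E] of all remaining constraints factorize together, so [op] can be applied to the
    first two without disturbing [E]. *)
Let good_cons k0 s : mutually_independent P X -> k0 \notin s -> good s ->
  good (k0 :: s).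
Proof.
move=> [mX _] k0s [mZ KZ indZ].
pose j0 := p k0.
pose E B D := [set w | forall j, j != j0 -> B j (Z s j w)] `&`
  [set w | forall k, k \notin k0 :: s -> D k (X k w)].
pose r B D := ((\prod_(j | j != j0) P (Z s j @^-1` B j)) *
  \prod_(k | k \notin k0 :: s) P (X k @^-1` D k))%E.
have split_event A C B D : measurable A -> measurable C ->
    (forall j, measurable (B j)) -> (forall k, measurable (D k)) ->
    P ((X k0 @^-1` C `&` Z s j0 @^-1` A) `&` E B D) =
    (P (X k0 @^-1` C) * P (Z s j0 @^-1` A) * r B D)%E.
  (* The invariant for [s] is used with [A] placed at the block [j0] and [C] at the free index
     [k0]. *)
  move=> mA mC mB mD.
  pose B' j := if j == j0 then A else B j.
  pose D' k := if k == k0 then C else D k.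
  have mB' j : measurable (B' j) by rewrite /B'; case: ifP.
  have mD' k : measurable (D' k) by rewrite /D'; case: ifP.
  transitivity (P (event s B' D')).
    congr (P _); apply/seteqP; split => w /=.
      move=> [[wC wA] [wB wD]]; split => [j|k ks].
        by rewrite /B'; have [->//|jj0] := eqVneq j j0; exact: wB.
      rewrite /D'; have [->//|kk0] := eqVneq k k0.
      by apply: wD; rewrite inE negb_or kk0.
    move=> [wB wD]; split; [split|split].
    - by have := wD _ k0s; rewrite /D' eqxx.
    - by have := wB j0; rewrite /B' eqxx.
    - by move=> j jj0; have := wB j; rewrite /B' (negbTE jj0).
    - move=> k; rewrite inE negb_or => /andP[kk0 ks].
      by have := wD k ks; rewrite /D' (negbTE kk0).
  rewrite (indZ _ _ mB' mD') (bigD1 j0)//= (bigD1 k0 k0s)/=.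
  rewrite /B' /D' !eqxx.
  under eq_bigr => j jj0 do rewrite (negbTE jj0).
  under [X in (_ * (_ * X))%E]eq_bigr => k /andP[_ kk0] do rewrite (negbTE kk0).
  rewrite (eq_bigl (fun k => k \notin k0 :: s)); last first.
    by move=> k; rewrite inE negb_or andbC.
  by rewrite muleACA; congr (_ * _)%E; exact: muleC.
have EP B D : (forall j, measurable (B j)) -> (forall k, measurable (D k)) ->
    P (E B D) = r B D.
  move=> mB mD; have := split_event _ _ _ _ measurableT measurableT mB mD.
  by rewrite !preimage_setT !setTI PsetT !mul1e.
have indXZ : independent2 P (X k0) (Z s j0).
  split=> // C A mC mA.
  have := split_event _ _ _ _ mA mC (fun=> measurableT) (fun=> measurableT).
  have -> : E (fun=> setT) (fun=> setT) = setT by apply/seteqP; split.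
  by rewrite setIT /r !big1 ?mule1// => ? _; rewrite preimage_setT PsetT.
have ZE j : Z (k0 :: s) j =
    if j == j0 then (fun w => op (X k0 w) (Z s j0 w)) else Z s j.
  apply/funext => w; rewrite /Z big_cons eq_sym.
  by have [->|] := eqVneq j j0; rewrite /j0.
have mXZ : measurable_fun [set: T] (fun w => (X k0 w, Z s j0 w)).
  exact: measurable_fun_pair.
split.
- move=> j; rewrite ZE; case: ifP => // _.
  exact: (measurableT_comp mop mXZ).
- move=> j; rewrite ZE big_cons eq_sym; have [->|//] := eqVneq j j0.
  exact: Kop.
move=> B D mB mD.
have mE : measurable (E B D).
  by apply: measurableI; exact: forall_measurable.
have := independent2_event _ _ _ _ indXZ mE _ _ (measurable_preimage _ _ mop (mB j0)).
have EBD : event (k0 :: s) B D = (fun w => (X k0 w, Z s j0 w)) @^-1`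
    ((fun u => op u.1 u.2) @^-1` B j0) `&` E B D.
  apply/seteqP; split => w /=.
    move=> [wB wD]; split; first by have := wB j0; rewrite ZE eqxx.
    by split=> // j jj0; have := wB j; rewrite ZE (negbTE jj0).
  move=> [w0 [wB wD]]; split=> // j; rewrite ZE.
  by have [->|jj0] := eqVneq j j0; last exact: wB.
rewrite EBD => ->; last by move=> C A mC mA; rewrite split_event ?EP.
rewrite EP// /r muleA; congr (_ * _)%E.
rewrite [in RHS](bigD1 j0)//= ZE eqxx; congr (_ * _)%E.
by apply: eq_bigr => j jj0; rewrite ZE (negbTE jj0).
Qed.

Lemma independent_grouping : mutually_independent P X ->
  mutually_independent P (fun j w => \big[op/e]_(k | p k == j) X k w) /\
  forall j, K (fun w => \big[op/e]_(k | p k == j) X k w)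
    (\big[op'/e']_(k | p k == j) v k).
Proof.
move=> indX; have [mX PX] := indX.
have : good (index_enum I).
  have : uniq (index_enum I) := index_enum_uniq I.
  elim: (index_enum I) => [_|k s IH /= /andP[ks us]]; last first.
    by apply: good_cons => //; exact: IH.
  have Z0 j : Z [::] j = cst e by apply/funext => w; rewrite /Z big_nil.
  split=> [j|j|B D mB mD]; rewrite ?Z0 ?big_nil//.
  under [X in (X * _)%E]eq_bigr do rewrite Z0.
  (* Empty blocks are the constant [e]: either every [B j] contains it and their product is 1, or
     some [B j] misses it and both sides vanish. *)
  have [Be|] := pselect (forall j, B j e).
    rewrite [X in (X * _)%E]big1 ?mul1e; last first.
      by move=> j _; rewrite preimage_cst mem_set// PsetT.
    rewrite -PX//; congr (P _); apply/seteqP; split => w /=.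
      by move=> [_ wD] k _; exact: wD.
    by move=> wD; split => [j|k _]; [rewrite Z0|exact: wD].
  move=> /existsNP[j nBj].
  rewrite (bigD1 j)//= preimage_cst memNset// measure0 !mul0e.
  rewrite (_ : event _ _ _ = set0) ?measure0//; apply/seteqP; split => w //=.
  by move=> [/(_ j)]; rewrite Z0.
move=> [mZ KZ indZ]; split; last exact: KZ.
split=> [|B mB]; first exact: mZ.
have := indZ B (fun=> setT) mB (fun=> measurableT).
rewrite [X in (_ * X)%E]big1 ?mule1 => [<-|k _]; last first.
  by rewrite preimage_setT PsetT.
congr (P _); apply/seteqP; split => w /=; first by move=> wB; split=> // j; exact: wB.
by move=> [wB _] j _; exact: wB.
Qed.

End grouping.

(** * Gaussian integrals and the square-exponential transform *)

(** The Radon-Nikodym derivative of [normal_prob m s] equals [normal_pdf m s] almost everywhere,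
    because both have the same integral over every measurable set. *)
Lemma ge0_integral_normal_prob {R : realType} (m s : R) (f : R -> R) :
  measurable_fun setT f -> (forall x, 0 <= f x) ->
  (\int[normal_prob m s]_x (f x)%:E =
   \int[lebesgue_measure]_x (f x * normal_pdf m s x)%:E)%E.
Proof.
move=> mf f0; have dom := @normal_prob_dominates R m s.
have mEf : measurable_fun setT (EFin \o f) by exact/measurable_EFinP.
have Ef0 x : (0 <= (EFin \o f) x)%E by rewrite lee_fin.
under [RHS]eq_integral do rewrite EFinM.
rewrite -(Radon_Nikodym_SigmaFinite.change_of_variables dom Ef0 measurableT mEf).
apply: ae_eq_integral => //.
- apply: emeasurable_funM => //.
  exact: (measurable_int _ (Radon_Nikodym_SigmaFinite.f_integrable dom)).
- apply: emeasurable_funM => //; apply/measurable_EFinP.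
  exact: measurable_normal_pdf.
- apply: ae_eqe_mul2l; apply: integral_ae_eq => //.
  + exact: Radon_Nikodym_SigmaFinite.f_integrable.
  + by apply/measurable_EFinP; exact: measurable_normal_pdf.
  + by move=> A _ mA; rewrite -Radon_Nikodym_SigmaFinite.f_integral.
Qed.

Lemma measurable_expR_sqr {R : realType} (lam y : R) :
  measurable_fun setT (fun x : R => expR (lam * (y + x) ^+ 2)).
Proof.
apply: measurableT_comp => //; apply: measurable_funM => //.
by apply: measurable_funX; exact: measurable_funD.
Qed.

(* Completing the square turns the integrand into a multiple of a normal
   density with variance [s ^+ 2 / (1 - 2 * lam * s ^+ 2)]. *)
Lemma integral_normal_expR_sqr {R : realType} (s lam y : R) :
  0 < s -> 2 * lam * s ^+ 2 < 1 ->
  (\int[normal_prob 0 s]_x (expR (lam * (y + x) ^+ 2))%:E =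
   ((Num.sqrt (1 - 2 * lam * s ^+ 2))^-1 *
    expR (lam * y ^+ 2 / (1 - 2 * lam * s ^+ 2)))%:E)%E.
Proof.
move=> s0 lams; pose D := 1 - 2 * lam * s ^+ 2; rewrite -/D.
have D0 : 0 < D by rewrite subr_gt0.
have sD0 : 0 < Num.sqrt D by rewrite sqrtr_gt0.
pose s' := s / Num.sqrt D; pose m' := 2 * lam * y * s ^+ 2 / D.
have s'0 : 0 < s' by rewrite divr_gt0.
have s'2 : s' ^+ 2 = s ^+ 2 / D by rewrite expr_div_n sqr_sqrtr// ltW.
pose C := (Num.sqrt D)^-1 * expR (lam * y ^+ 2 / D).
rewrite ge0_integral_normal_prob//; last exact: measurable_expR_sqr.
transitivity (\int[lebesgue_measure]_x (C%:E * (normal_pdf m' s' x)%:E))%E.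
  apply: eq_integral => x _; rewrite -EFinM; congr EFin.
  rewrite !normal_pdfE ?gt_eqF// /normal_fun.
  have -> : normal_peak s' = Num.sqrt D * normal_peak s.
    rewrite /normal_peak s'2.
    rewrite (_ : s ^+ 2 / D * pi *+ 2 = D^-1 * (s ^+ 2 * pi *+ 2)); last by ring.
    by rewrite sqrtrM ?invr_ge0 ?ltW// sqrtrV ?ltW// invfM invrK.
  rewrite /C mulrCA [RHS](_ : _ = normal_peak s * (expR (lam * y ^+ 2 / D) *
    expR (- (x - m') ^+ 2 / (s' ^+ 2 *+ 2)))); last first.
    by field; rewrite gt_eqF.
  congr (_ * _); rewrite -!expRD; congr expR.
  rewrite s'2 /m'; have Dn : D != 0 by rewrite gt_eqF.
  have sn : s != 0 by rewrite gt_eqF.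
  (* Eliminating [lam] in favour of [D] turns the equality of exponents into a rational identity in
     independent quantities. *)
  rewrite subr0; have lamE : lam = (1 - D) / (2 * s ^+ 2) by rewrite /D; field.
  by move: Dn; move: (D) lamE => d -> dn; field; rewrite dn sn.
rewrite ge0_integralZl//.
- by rewrite integral_normal_pdf mule1.
- by apply/measurable_EFinP; exact: measurable_normal_pdf.
- by move=> x _; rewrite lee_fin normal_pdf_ge0.
- by rewrite lee_fin mulr_ge0 ?expR_ge0// invr_ge0 ltW.
Qed.

(** A property of the law N(0, v), where [v = 0] stands for the point mass at 0. The free shift [y]
    is what makes it stable under sums: it can hold the value of the other summand. *)
Definition gaussian_square {dT : measure_display} {T : measurableType dT}
  {R : realType} (P : probability T R) (Y : T -> R) (v : R) : Prop :=
  0 <= v /\ forall lam y : R, 2 * lam * v < 1 ->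
    (\int[P]_w (expR (lam * (y + Y w) ^+ 2))%:E =
     ((Num.sqrt (1 - 2 * lam * v))^-1 *
      expR (lam * y ^+ 2 / (1 - 2 * lam * v)))%:E)%E.

Section gaussian_square.
Context {dT : measure_display} {T : measurableType dT} {R : realType}.
Variable P : probability T R.

Lemma gaussian_square0 : gaussian_square P (cst 0) 0.
Proof.
split=> // lam y _; rewrite mulr0 subr0 sqrtr1 invr1 mul1r mulr1.
under eq_integral => w _ do rewrite addr0.
by rewrite integral_cst//= probability_setT mule1.
Qed.

Lemma gaussian_square_normal (Y : T -> R) (s a : R) :
  measurable_fun setT Y -> has_normal_law P Y 0 s -> 0 < s ->
  gaussian_square P (fun w => a * Y w) ((a * s) ^+ 2).
Proof.
(* For nonzero [a] the scale is pulled out, [y + a * Y = a * (y / a + Y)], which turns [lam] into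
   [lam * a ^+ 2]; hence the separate case [a = 0]. *)
move=> mY lawY s0; have [->|a0] := eqVneq a 0.
  have -> : (fun w => 0 * Y w) = cst 0 by apply/funext => w; rewrite mul0r.
  by rewrite mul0r expr0n; exact: gaussian_square0.
split=> [|lam y h]; first exact: sqr_ge0.
have mY' : measurable_fun setT (Y : T -> measurableTypeR R) by exact: mY.
pose Y' : {mfun T >-> measurableTypeR R} :=
  HB.pack (Y : T -> measurableTypeR R) (isMeasurableFun.Build _ _ _ _ _ mY').
have lE : 2 * lam * (a * s) ^+ 2 = 2 * (lam * a ^+ 2) * s ^+ 2 by ring.
transitivity (\int[normal_prob 0 s]_x
    (expR (lam * a ^+ 2 * (y / a + x) ^+ 2))%:E)%E.
  transitivity (\int[distribution P Y']_x
      (expR (lam * a ^+ 2 * (y / a + x) ^+ 2))%:E)%E.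
    rewrite ge0_integral_distribution; last 2 first.
    - by apply/measurable_EFinP; exact: measurable_expR_sqr.
    - by move=> x; rewrite lee_fin expR_ge0.
    apply: eq_integral => w _ /=; congr (expR _)%:E.
    by field.
  by apply: eq_measure_integral => B mB _; exact: lawY.
rewrite integral_normal_expR_sqr//; last by rewrite -lE.
rewrite lE; congr (_ * expR _)%:E.
by congr (_ / _); field.
Qed.

(** Integrating out [Y] at shift [y + Z] leaves a multiple of the same exponential in [Z] with
    parameter [lam / D], where [D = 1 - 2 * lam * u]. The two normalizations multiply to the one for
    [u + v]. *)
Lemma gaussian_squareD (Y Z : T -> R) (u v : R) : independent2 P Y Z ->
  gaussian_square P Y u -> gaussian_square P Z v ->
  gaussian_square P (fun w => Y w + Z w) (u + v).
Proof.
move=> indYZ [u0 KY] [v0 KZ]; split=> [|lam y h]; first exact: addr_ge0.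
(* For [lam >= 0] this follows from [v >= 0]; for negative [lam] the left side is nonpositive. *)
have hu : 2 * lam * u < 1.
  have [l0|l0] := leP 0 lam.
    by apply: le_lt_trans h; rewrite ler_wpM2l ?mulr_ge0// lerDl.
  by apply: le_lt_trans ltr01; rewrite mulr_le0_ge0// nmulr_lle0// ltW.
pose D := 1 - 2 * lam * u; have D0 : 0 < D by rewrite subr_gt0.
have Dn : D != 0 by rewrite gt_eqF.
have DE : 1 - 2 * (lam / D) * v = (1 - 2 * lam * (u + v)) / D.
  by rewrite /D in Dn *; field.
have hv : 2 * (lam / D) * v < 1.
  by rewrite -subr_gt0 DE divr_gt0// subr_gt0.
have D2n : 1 - 2 * lam * (u + v) != 0 by rewrite gt_eqF// subr_gt0.
rewrite (ge0_integral_independent2 P Y Z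
  (fun x => expR (lam * (y + (x.1 + x.2)) ^+ 2)))//=; last first.
  apply: (measurableT_comp (measurable_expR_sqr lam y)).
  by apply: measurable_funD; [exact: measurable_fst|exact: measurable_snd].
transitivity (\int[P]_w ((Num.sqrt D)^-1%:E *
    (expR (lam / D * (y + Z w) ^+ 2))%:E))%E.
  apply: eq_integral => w _.
  under eq_integral => w' _ do rewrite [Y w' + Z w]addrC addrA.
  by rewrite KY// -EFinM; congr (_ * expR _)%:E; rewrite /D; ring.
have [_ mZ _] := indYZ.
rewrite ge0_integralZl//.
- rewrite KZ// DE -EFinM mulrA -invfM -sqrtrM ?ltW//.
  congr ((Num.sqrt _)^-1 * expR _)%:E; first by field.
  by field; rewrite Dn D2n.
- apply/measurable_EFinP.
  exact: (measurableT_comp (measurable_expR_sqr _ _) mZ).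
Qed.

End gaussian_square.

(** * Expectations over independent families, and the Chernoff bound *)

Section independent_family.
Context {dT : measure_display} {T : measurableType dT} {R : realType}.
Variable P : probability T R.

Lemma mutually_independent_comp (I : finType) (X : I -> T -> R)
    (f : I -> R -> R) :
  mutually_independent P X -> (forall k, measurable_fun setT (f k)) ->
  mutually_independent P (fun k w => f k (X k w)).
Proof.
move=> [mX PX] mf; split=> [k|B mB].
  exact: (measurableT_comp (mf k) (mX k)).
apply: (PX (fun k => f k @^-1` B k)) => k.
exact: measurable_preimage.
Qed.

Lemma expectation_prod (J : finType) (Y : J -> T -> R) (u : J -> R) :
  mutually_independent P Y -> (forall j w, 0 <= Y j w) ->
  (forall j, (\int[P]_w (Y j w)%:E = (u j)%:E)%E) ->
  (\int[P]_w (\prod_j Y j w)%:E = (\prod_j u j)%:E)%E.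
Proof.
move=> indY Y0 EY.
pose K (Z : T -> R) (z : R) :=
  [/\ measurable_fun setT Z, forall w, 0 <= Z w &
    (\int[P]_w (Z w)%:E = z%:E)%E].
have mop : measurable_fun setT (fun x : R * R => x.1 * x.2).
  by apply: measurable_funM; [exact: measurable_fst|exact: measurable_snd].
have K1 : K (cst 1) 1.
  split=> //.
  by rewrite /= integral_cst//= probability_setT mule1.
have KY j : K (Y j) (u j) by split=> //; have [mY _] := indY; exact: mY.
have KM Y' Z y z : independent2 P Y' Z -> K Y' y -> K Z z ->
    K (fun w => Y' w * Z w) (y * z).
  move=> indYZ [mY Y'0 EY'] [mZ Z0 EZ].
  split; [exact: measurable_funM|by move=> w; rewrite mulr_ge0|].
  (* Absolute values make the integrand nonnegative on the whole plane, as the Tonelli lemma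
     demands. *)
  have -> : (\int[P]_w (Y' w * Z w)%:E = \int[P]_w (`|Y' w| * `|Z w|)%:E)%E.
    by apply: eq_integral => w _; rewrite !ger0_norm.
  rewrite (ge0_integral_independent2 P Y' Z (fun x => `|x.1| * `|x.2|))//=.
  - transitivity (\int[P]_w (y%:E * (Z w)%:E))%E.
      apply: eq_integral => w _; rewrite -EY'.
      rewrite muleC -ge0_integralZl//.
      + by apply: eq_integral => w' _; rewrite !ger0_norm// -EFinM mulrC.
      + exact/measurable_EFinP.
      + by move=> w' _; rewrite lee_fin.
      + by rewrite lee_fin.
    rewrite ge0_integralZl//.
    + by rewrite EZ.
    + exact/measurable_EFinP.
    + by move=> w _; rewrite lee_fin.
    + by rewrite -EY' integral_ge0// => w _; rewrite lee_fin.
  - by apply: measurable_funM; apply: measurableT_comp.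
(* Grouping along the map to [unit] puts the whole family in one block, with multiplication as the
   operation and the expectation as the invariant. *)
have [_ /(_ tt)[_ _]] := independent_grouping P J unit Y (fun=> tt)
  *%R 1 *%R 1 K u mop K1 KY KM indY.
exact.
Qed.

(** The block sums are independent, and each has the transform of N(0, B); the exponential of the
    sum of squares therefore has an expectation that splits into [#|J|] equal factors, each read off
    at shift 0. *)
Lemma expectation_expR_sum_sqr (I J : finType) (X : I -> T -> R) (p : I -> J)
    (alpha s : I -> R) (lam B : R) :
  mutually_independent P X -> (forall k, has_normal_law P (X k) 0 (s k)) ->
  (forall k, 0 < s k) ->
  (forall j, \sum_(k | p k == j) (alpha k * s k) ^+ 2 = B) ->
  2 * lam * B < 1 ->
  (\int[P]_w (expR (lam * \sum_j (\sum_(k | p k == j) alpha k * X k w) ^+ 2))%:E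
   = ((Num.sqrt (1 - 2 * lam * B))^-1 ^+ #|J|)%:E)%E.
Proof.
move=> indX lawX s0 sumB lamB; have [mX _] := indX.
have indaX : mutually_independent P (fun k w => alpha k * X k w).
  apply: (mutually_independent_comp _ X (fun k x => alpha k * x)) => // k.
  exact: measurable_funM.
have mop : measurable_fun setT (fun x : R * R => x.1 + x.2).
  by apply: measurable_funD; [exact: measurable_fst|exact: measurable_snd].
have KX k : gaussian_square P (fun w => alpha k * X k w) ((alpha k * s k) ^+ 2).
  exact: gaussian_square_normal.
have [indV KV] := independent_grouping P I J _ p +%R 0 +%R 0
  (gaussian_square P) _ mop (gaussian_square0 P) KX (gaussian_squareD P) indaX.
under eq_integral => w _ do rewrite mulr_sumr expR_sum.
rewrite (expectation_prod _ (fun j w =>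
    expR (lam * (\sum_(k | p k == j) alpha k * X k w) ^+ 2))
    (fun=> (Num.sqrt (1 - 2 * lam * B))^-1)).
- by rewrite prodr_const.
- apply: (mutually_independent_comp _ _ (fun _ x => expR (lam * x ^+ 2)) indV).
  move=> j; apply: eq_measurable_fun (measurable_expR_sqr lam 0) => x _.
  by rewrite add0r.
- by move=> j w; exact: expR_ge0.
- move=> j; have [_ /(_ lam 0)] := KV j; rewrite sumB => /(_ lamB).
  rewrite expr0n mulr0 mul0r expR0 mulr1 => <-.
  by apply: eq_integral => w _; rewrite add0r.
Qed.

End independent_family.

(* AM-GM replaces the Cauchy-Schwarz inequality of the usual argument: when
   [U <= V] the two exponentials below, weighted by [c] and [c^-1], have a
   product at least 1, and [c] is chosen to balance their expectations. *)
Lemma chernoff_le {dT : measure_display} {T : measurableType dT} {R : realType}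
    (P : probability T R) (U V : T -> R) (theta alpha beta : R) :
  measurable_fun setT U -> measurable_fun setT V ->
  0 <= theta -> 0 < alpha -> 0 < beta ->
  (\int[P]_w (expR (theta * V w))%:E = alpha%:E)%E ->
  (\int[P]_w (expR (- theta * U w))%:E = beta%:E)%E ->
  (P [set w | (U w <= V w)%R] <= (Num.sqrt (alpha * beta))%:E)%E.
Proof.
move=> mU mV theta0 alpha0 beta0 EV EU.
pose c := Num.sqrt (beta / alpha).
have c0 : 0 < c by rewrite sqrtr_gt0 divr_gt0.
have mUV : measurable [set w | U w <= V w].
  rewrite -[X in measurable X]setTI.
  exact: measurable_fun_le.
have mEV : measurable_fun setT (fun w => (expR (theta * V w))%:E).
  by apply/measurable_EFinP/measurableT_comp => //; exact: measurable_funM.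
have mEU : measurable_fun setT (fun w => (expR (- theta * U w))%:E).
  by apply/measurable_EFinP/measurableT_comp => //; exact: measurable_funM.
have -> : (Num.sqrt (alpha * beta))%:E =
    ((c / 2)%:E * alpha%:E + (c^-1 / 2)%:E * beta%:E)%E.
  rewrite -!EFinM -EFinD; congr EFin.
  have [sa0 sb0] : 0 < Num.sqrt alpha /\ 0 < Num.sqrt beta by rewrite !sqrtr_gt0.
  have aE : alpha = Num.sqrt alpha ^+ 2 by rewrite sqr_sqrtr// ltW.
  have bE : beta = Num.sqrt beta ^+ 2 by rewrite sqr_sqrtr// ltW.
  rewrite /c !sqrtrM ?ltW// sqrtrV ?ltW//.
  move: aE bE sa0 sb0; move: (Num.sqrt alpha) (Num.sqrt beta) => r s -> -> r0 s0.
  by field; rewrite !gt_eqF.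
have c20 : 0 <= c / 2 by rewrite divr_ge0// ltW.
have cV20 : 0 <= c^-1 / 2 by rewrite divr_ge0// invr_ge0 ltW.
rewrite -EV -EU -ge0_integralZl_EFin//.
rewrite -ge0_integralZl_EFin// -ge0_integralD//; last 4 first.
- by move=> w _; rewrite -EFinM lee_fin mulr_ge0 ?expR_ge0.
- exact: measurable_funeM.
- by move=> w _; rewrite -EFinM lee_fin mulr_ge0 ?expR_ge0.
- exact: measurable_funeM.
(* The probability is the integral of an indicator, to be dominated pointwise by the weighted sum of
   exponentials. *)
rewrite -[X in P X]setIT -integral_indic//.
apply: ge0_le_integral => //=.
- by apply/measurable_EFinP; exact: measurable_indic.
- by apply: emeasurable_funD; exact: measurable_funeM.
move=> w _; rewrite -!EFinM -EFinD lee_fin indicE.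
have [x0 y0] : 0 < expR (theta * V w) /\ 0 < expR (- theta * U w).
  by rewrite !expR_gt0.
case: (boolP (w \in _)) => [|_]; last first.
  by rewrite addr_ge0// mulr_ge0 ?divr_ge0 ?invr_ge0// ltW.
rewrite inE /= => UV.
have xy1 : 1 <= expR (theta * V w) * expR (- theta * U w).
  by rewrite -expRD -expR0 ler_expR mulNr -mulrBr mulr_ge0// subr_ge0.
rewrite mulr1n !(mulrAC _ 2^-1).
set p := c * _; set q := c^-1 * _.
have p0 : 0 < p by rewrite mulr_gt0.
have q0 : 0 < q by rewrite mulr_gt0// invr_gt0.
have pq : 1 <= p * q by rewrite /p /q mulrACA divff ?gt_eqF// mul1r.
(* With [p * q >= 1] this gives [(p + q) ^+ 2 >= 4], so the mean of [p] and [q] is at least 1. *)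
have := sqr_ge0 (p - q).
nra.
Qed.

(** * Two-valued labels and the linear coefficients of a point minus a centroid *)

Lemma other_neq (l : 'I_2) : other l != l.
Proof. by rewrite -val_eqE /= inordK; case: l => [[|[|m]] lm]. Qed.

Lemma neq_other (k l : 'I_2) : k != l -> k = other l.
Proof.
move=> kl; apply/val_inj; move: kl; rewrite -val_eqE /= inordK.
  by case: k l => [[|[|k]] kP] [[|[|l]] lP].
by case: l => [[|[|m]] lm].
Qed.

Lemma big_other {R : nmodType} (F : 'I_2 -> R) (l : 'I_2) :
  \sum_k F k = F l + F (other l).
Proof.
rewrite (bigD1 l)//=; congr (_ + _).
rewrite (bigD1 (other l)) ?other_neq//= big1 ?addr0// => k /andP[kl].
by rewrite (neq_other _ _ kl) eqxx.
Qed.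

Lemma sum_block {V : nmodType} (n d : nat) (t : 'I_d)
    (F : ('I_2 * 'I_d) + ('I_n * 'I_d) -> V)
    (p := fun k : ('I_2 * 'I_d) + ('I_n * 'I_d) =>
       match k with inl (_, t) => t | inr (_, t) => t end) :
  \sum_(k | p k == t) F k = \sum_l F (inl (l, t)) + \sum_m F (inr (m, t)).
Proof.
rewrite big_sumType /=; congr (_ + _).
  rewrite (eq_bigl (fun u => true && (u.2 == t))); last by case.
  rewrite (eq_bigr (fun u => F (inl (u.1, u.2)))); last by case.
  rewrite -(pair_big xpredT (pred1 t) (fun l u => F (inl (l, u)))) /=.
  by apply: eq_bigr => l _; rewrite big_pred1_eq.
rewrite (eq_bigl (fun u => true && (u.2 == t))); last by case.
rewrite (eq_bigr (fun u => F (inr (u.1, u.2)))); last by case.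
rewrite -(pair_big xpredT (pred1 t) (fun l u => F (inr (l, u)))) /=.
by apply: eq_bigr => l _; rewrite big_pred1_eq.
Qed.

Section coefficients.
Context {R : realType} {n : nat}.
Variables (z c : 'I_n -> 'I_2) (i : 'I_n) (k : 'I_2).
Hypothesis Ck : exists m, c m = k.

Let N : R := #|lblset c k|%:R.

(** [center_coef l] and [noise_coef m] are the weights of [mu l t] and [xi m t] in
    [x i t - centroid c x k t]; they do not depend on the coordinate [t]. *)
Definition center_coef (l : 'I_2) : R := (l == z i)%:R - purity z c l k.

Definition noise_coef (m : 'I_n) : R := (m == i)%:R - (c m == k)%:R / N.

Lemma card_lblset_gt0 : (0 < #|lblset c k|)%N.
Proof. by have [m cm] := Ck; apply/card_gt0P; exists m; rewrite inE cm. Qed.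

Let N_neq0 : N != 0. Proof. by rewrite pnatr_eq0 -lt0n card_lblset_gt0. Qed.

Lemma sub_centroid (d : nat) (mu : 'I_2 -> 'I_d -> R) (xi : 'I_n -> 'I_d -> R)
    (x := fun m t => mu (z m) t + xi m t) (t : 'I_d) :
  x i t - centroid c x k t =
  \sum_l center_coef l * mu l t + \sum_m noise_coef m * xi m t.
Proof.
have -> : \sum_l center_coef l * mu l t =
    mu (z i) t - N^-1 * \sum_(m in lblset c k) mu (z m) t.
  under eq_bigr do rewrite mulrBl.
  rewrite sumrB; congr (_ - _).
    rewrite (bigD1 (z i))//= eqxx mul1r big1 ?addr0// => l /negbTE ->.
    by rewrite mul0r.
  (* Splitting the cluster by true class, class [l] contributes as many copies of [mu l t] as it has
     points in the cluster, whence the purity. *)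
  rewrite (partition_big z xpredT)//= mulr_sumr; apply: eq_bigr => l _.
  rewrite (eq_bigr (fun=> mu l t)) => [|m /andP[_ /eqP ->]//].
  rewrite (eq_bigl (mem (lblset c k :&: lblset z l))) => [|m]; last by rewrite !inE.
  by rewrite sumr_const -[_ *+ _]mulr_natr /purity -/N; ring.
have -> : \sum_m noise_coef m * xi m t =
    xi i t - N^-1 * \sum_(m in lblset c k) xi m t.
  under eq_bigr do rewrite mulrBl.
  rewrite sumrB; congr (_ - _).
    rewrite (bigD1 i)//= eqxx mul1r big1 ?addr0// => m /negbTE ->.
    by rewrite mul0r.
  rewrite mulr_sumr [RHS]big_mkcond/=; apply: eq_bigr => m _; rewrite inE.
  by case: eqP => _; rewrite ?mul1r ?mul0r.
by rewrite /centroid /x big_split /= -/N; ring.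
Qed.

Lemma sum_purity : \sum_l purity z c l k = 1 :> R.
Proof.
rewrite -mulr_suml -natr_sum -[RHS](divff N_neq0); congr (_%:R / _).
rewrite -sum1_card (partition_big z xpredT)//=; apply: eq_bigr => l _.
by rewrite -sum1_card; apply: eq_bigl => m; rewrite !inE.
Qed.

(** The two purities sum to 1, so the two coefficients are opposite numbers [1 - R] and
    [-(1 - R)]. *)
Lemma sum_center_coef :
  \sum_l center_coef l ^+ 2 = 2 * (1 - purity z c (z i) k) ^+ 2.
Proof.
rewrite (big_other _ (z i)) /center_coef eqxx (negbTE (other_neq _)).
have := sum_purity; rewrite (big_other _ (z i)) => /(canRL (addKr _)) ->.
by rewrite mulr1n mulr0n; ring.
Qed.

(** The value is [(N - 1) / N] when [i] lies in the cluster and [(N + 1) / N] otherwise: the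
    reciprocal of the Hartigan weight. *)
Lemma sum_noise_coef :
  \sum_m noise_coef m ^+ 2 = 1 + (1 - 2 * (c i == k)%:R) / N.
Proof.
have -> : \sum_m noise_coef m ^+ 2 = \sum_m ((m == i)%:R *
    (1 - 2 * (c i == k)%:R / N) + (c m == k)%:R / N ^+ 2).
  apply: eq_bigr => m _; rewrite /noise_coef.
  by have [->|_] := eqVneq m i; case: (c _ == k);
    rewrite ?mulr1n ?mulr0n; field.
rewrite big_split/= -!mulr_suml -!natr_sum.
rewrite (_ : (\sum_m (m == i))%N = 1%N); last first.
  rewrite (bigD1 i)//= eqxx big1 ?addn0// => m /negbTE -> //.
rewrite (_ : (\sum_m (c m == k))%N = #|lblset c k|); last first.
  rewrite -sum1_card [RHS]big_mkcond/=.
  by apply: eq_bigr => m _; rewrite inE; case: eqP.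
by rewrite -/N; field.
Qed.

Definition hartigan_weight : R := if c i == k then N / (N - 1) else N / (N + 1).

Lemma hartigan_weight_noise : (c i == k -> 1 < N) ->
  hartigan_weight * \sum_m noise_coef m ^+ 2 = 1.
Proof.
rewrite sum_noise_coef /hartigan_weight; case: (c i == k) => [/(_ isT) N1|_].
  by rewrite mulr1n; field; rewrite N_neq0 subr_eq0 gt_eqF.
by rewrite mulr0n; field; rewrite N_neq0 gt_eqF// addr_gt0// ltr0n card_lblset_gt0.
Qed.

Lemma hartigan_weight_gt0 : (c i == k -> 1 < N) -> 0 < hartigan_weight.
Proof.
have N0 : 0 < N by rewrite ltr0n; exact: card_lblset_gt0.
rewrite /hartigan_weight; case: (c i == k) => [/(_ isT) N1|_].
  by rewrite divr_gt0// subr_gt0.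
by rewrite divr_gt0// addr_gt0.
Qed.

(** At purity 1 the intersection with the class has as many elements as the cluster, so the cluster
    lies inside the class. *)
Lemma purity_ge1 (l : 'I_2) (m : 'I_n) :
  1 <= purity z c l k :> R -> c m = k -> z m = l.
Proof.
rewrite ler_pdivlMr ?ltr0n ?card_lblset_gt0// mul1r ler_nat => le_card cm.
have /eqP/finset.setIidPl/fintype.subsetP/(_ m) : lblset c k :&: lblset z l == lblset c k.
  by rewrite eqEcard finset.subsetIl.
by rewrite !inE cm eqxx => /(_ isT)/eqP.
Qed.

(** The intersection of the cluster with the class of [i] contains [i] and is strictly smaller than
    the cluster. *)
Lemma card_lblset_gt1 : c i = k -> purity z c (z i) k < 1 :> R -> 1 < N.
Proof.
move=> ci; rewrite ltr_pdivrMr ?ltr0n ?card_lblset_gt0// mul1r ltr_nat ltr1n.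
apply: leq_trans; rewrite ltnS card_gt0; apply/finset.set0Pn; exists i.
by rewrite !inE ci !eqxx.
Qed.

End coefficients.

(** * The transform of a Hartigan distance, and the final estimate *)

(** Each coordinate of [x i] minus the centroid is one block of the family, with variance [v / W],
    where [W] is the Hartigan weight. The factor [W] in front of the squares moves into the
    parameter, and [lam * W] times [v / W] restores [lam * v]. *)
Lemma expectation_expR_hartigan {R : realType} {dT : measure_display}
    {T : measurableType dT} (P : probability T R) (n d : nat) (tau sigma : R)
    (mu : 'I_2 -> 'I_d -> T -> R) (xi : 'I_n -> 'I_d -> T -> R)
    (z c : 'I_n -> 'I_2) (i : 'I_n) (k : 'I_2) (lam v : R)
    (x := fun w m t => mu (z m) t w + xi m t w) :
  0 < tau -> 0 < sigma ->
  mutually_independent P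
    (fun k : ('I_2 * 'I_d) + ('I_n * 'I_d) =>
       match k with inl (l, t) => mu l t | inr (m, t) => xi m t end) ->
  (forall l t, has_normal_law P (mu l t) 0 tau) ->
  (forall m t, has_normal_law P (xi m t) 0 sigma) ->
  (exists m, c m = k) -> (c i == k -> 1 < #|lblset c k|%:R :> R) ->
  v = 2 * tau ^+ 2 * (hartigan_weight c i k * (1 - purity z c (z i) k) ^+ 2)
      + sigma ^+ 2 ->
  2 * lam * v < 1 ->
  (\int[P]_w (expR (lam * hartigan c (x w) i k))%:E =
   ((Num.sqrt (1 - 2 * lam * v))^-1 ^+ d)%:E)%E.
Proof.
move=> tau0 sigma0 indX lawmu lawxi Ck N1 vE lamv.
set X := (X in mutually_independent P X) in indX.
pose W : R := hartigan_weight c i k.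
have W0 : 0 < W by exact: hartigan_weight_gt0.
pose p (u : ('I_2 * 'I_d) + ('I_n * 'I_d)) : 'I_d :=
  match u with inl (_, t) => t | inr (_, t) => t end.
pose alpha (u : ('I_2 * 'I_d) + ('I_n * 'I_d)) : R :=
  match u with inl (l, _) => center_coef z c i k l
             | inr (m, _) => noise_coef c i k m end.
pose s (u : ('I_2 * 'I_d) + ('I_n * 'I_d)) : R :=
  match u with inl _ => tau | inr _ => sigma end.
have hartiganE w : hartigan c (x w) i k =
    W * \sum_t (\sum_(u | p u == t) alpha u * X u w) ^+ 2.
  congr (_ * _); apply: eq_bigr => t _; congr (_ ^+ 2).
  by rewrite (sub_centroid z c i k _ (fun l t => mu l t w) (fun m t => xi m t w))
    sum_block.
have sumB t : \sum_(u | p u == t) (alpha u * s u) ^+ 2 = v / W.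
  rewrite sum_block /=.
  under eq_bigr do rewrite exprMn.
  under [X in _ + X]eq_bigr do rewrite exprMn.
  rewrite -!mulr_suml sum_center_coef//.
  have /(canRL (mulKf (lt0r_neq0 W0))) -> :=
    hartigan_weight_noise c i k Ck N1.
  by rewrite vE -/W; field; rewrite gt_eqF.
have WvE : 2 * (lam * W) * (v / W) = 2 * lam * v by field; rewrite gt_eqF.
under eq_integral => w _ do rewrite hartiganE mulrA.
rewrite (expectation_expR_sum_sqr P _ _ X p alpha s _ (v / W)) ?WvE ?card_ord//.
- by move=> [[l t]|[m t]]; [exact: lawmu|exact: lawxi].
- by case.
Qed.

Theorem theorem3p9 (R : realType) (dT : measure_display) (T : measurableType dT)
  (P : probability T R) (n d : nat) (tau sigma : R)
  (mu : 'I_2 -> 'I_d -> T -> R) (xi : 'I_n -> 'I_d -> T -> R)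
  (z c : 'I_n -> 'I_2) (i : 'I_n) :
  (2 <= n)%N -> (1 <= d)%N -> 0 < tau -> 0 < sigma ->
  mutually_independent P
    (fun k : ('I_2 * 'I_d) + ('I_n * 'I_d) =>
       match k with inl (l, t) => mu l t | inr (m, t) => xi m t end) ->
  (forall l t, has_normal_law P (mu l t) 0 tau) ->
  (forall m t, has_normal_law P (xi m t) 0 sigma) ->
  (forall l : 'I_2, exists m, z m = l) ->
  (forall k : 'I_2, exists m, c m = k) ->
  let l := z i in let j := c i in let jb := other j in
  let Rj : R := purity z c l j in
  let Rjb : R := purity z c l jb in
  0 < Rj -> Rj <= Rjb -> Rjb <= 1 ->
  let Nj : R := (#|lblset c j|)%:R in
  let Njb : R := (#|lblset c jb|)%:R in
  let a := Nj / (Nj - 1) * (1 - Rj) ^+ 2 in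
  let b := Njb / (Njb + 1) * (1 - Rjb) ^+ 2 in
  let rho := 1 - (tau ^+ 2 * (a - b) / (tau ^+ 2 * (a + b) + sigma ^+ 2)) ^+ 2 in
  let x : T -> 'I_n -> 'I_d -> R := fun w m t => mu (z m) t w + xi m t w in
  (P [set w | (hartigan c (x w) i j <= hartigan c (x w) i jb)%R] <=
     (rho `^ (d%:R / 4))%:E)%E /\ 0 <= rho < 1.
Proof.
move=> _ _ tau0 sigma0 indX lawmu lawxi zS cS l j jb Rj Rjb Rj0 RjRjb Rjb1
  Nj Njb a b rho x.
(* Otherwise both clusters would have purity 1 for [l], all points would belong to class [l], and
   the other class would be empty. *)
have Rj1 : Rj < 1.
  rewrite ltNge; apply/negP => Rj1; have Rjb1' := le_trans Rj1 RjRjb.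
  have [m zm] := zS (other l); have : z m = l.
    have [cm|/neq_other cm] := eqVneq (c m) j.
      exact: (purity_ge1 _ _ _ (cS j) _ _ Rj1 cm).
    exact: (purity_ge1 _ _ _ (cS jb) _ _ Rjb1' cm).
  by rewrite zm => /eqP; rewrite (negbTE (other_neq l)).
have Nj1 : 1 < Nj by exact: (card_lblset_gt1 z c i j (cS j) erefl Rj1).
have Njb0 : 0 < Njb by rewrite ltr0n card_lblset_gt0.
have b0 : 0 <= b by rewrite mulr_ge0 ?sqr_ge0// divr_ge0 ?addr_ge0// ltW.
(* The weight in [a] exceeds 1 and the one in [b] is below 1, so the chain runs through
   [(1 - Rjb) ^+ 2 <= (1 - Rj) ^+ 2]. *)
have ba : b < a.
  apply: (@le_lt_trans _ _ ((1 - Rj) ^+ 2)); last first.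
    rewrite ltr_pMl ?exprn_gt0 ?subr_gt0// ltr_pdivlMr ?subr_gt0//.
    by rewrite mul1r gtrBl.
  apply: (@le_trans _ _ ((1 - Rjb) ^+ 2)).
    by rewrite ler_piMl ?sqr_ge0// ler_pdivrMr ?addr_gt0// mul1r lerDl.
  by rewrite ler_pXn2r ?nnegrE ?subr_ge0 ?lerB// ltW.
have sigma20 : 0 < sigma ^+ 2 by rewrite exprn_gt0.
have tau20 : 0 < tau ^+ 2 by rewrite exprn_gt0.
pose A := 2 * tau ^+ 2 * a + sigma ^+ 2.
pose B := 2 * tau ^+ 2 * b + sigma ^+ 2.
have B0 : 0 < B by rewrite ltr_wpDl// mulr_ge0// mulr_ge0// ltW.
have BA : B < A by rewrite ltrD2r ltr_pM2l// mulr_gt0.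
have A0 : 0 < A by exact: lt_trans BA.
have AB0 : 0 < A + B by rewrite addr_gt0.
(* The fraction in [rho] is [(A - B) / (A + B)], its numerator and denominator both being half of
   these. *)
have rhoE : rho = 4 * A * B / (A + B) ^+ 2.
  have -> : rho = 1 - ((A - B) / (A + B)) ^+ 2.
    rewrite /rho; congr (1 - _ ^+ 2).
    have -> : A - B = 2 * (tau ^+ 2 * (a - b)) by rewrite /A /B; ring.
    have -> : A + B = 2 * (tau ^+ 2 * (a + b) + sigma ^+ 2).
      by rewrite /A /B; ring.
    by rewrite -mulf_div divff// mul1r.
  by field; rewrite gt_eqF.
have rho0 : 0 < rho by rewrite rhoE divr_gt0 ?exprn_gt0// !mulr_gt0.
split; last first.
  rewrite ltW//= rhoE ltr_pdivrMr ?exprn_gt0// mul1r -subr_gt0.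
  rewrite (_ : _ - _ = (A - B) ^+ 2); last by ring.
  by rewrite exprn_gt0// subr_gt0.
(* [theta] maximizes [(1 - 2 * theta * B) * (1 + 2 * theta * A)], and the
   maximum is [1 / rho]. *)
pose theta := (A - B) / (4 * A * B).
have theta0 : 0 <= theta by rewrite divr_ge0 ?subr_ge0 ?mulr_ge0// ltW.
have thB : 1 - 2 * theta * B = (A + B) / (2 * A).
  by rewrite /theta; field; rewrite !gt_eqF.
have thA : 1 - 2 * - theta * A = (A + B) / (2 * B).
  by rewrite /theta; field; rewrite !gt_eqF.
have [qA0 qB0] : 0 < (A + B) / (2 * A) /\ 0 < (A + B) / (2 * B).
  by rewrite !divr_gt0// mulr_gt0.
have mX := indX.1.
have mmu l' t : measurable_fun setT (mu l' t) by exact: (mX (inl (l', t))).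
have mxi m t : measurable_fun setT (xi m t) by exact: (mX (inr (m, t))).
have mhartigan k : measurable_fun setT (fun w => hartigan c (x w) i k).
  apply: measurable_funM => //; apply: measurable_sum => t.
  apply: measurable_funX; apply: measurable_funB; first exact: measurable_funD.
  apply: measurable_funM => //; under eq_fun do rewrite -big_enum /=.
  apply: measurable_sum => m; exact: measurable_funD.
have jjb : (c i == jb) = false by rewrite eq_sym (negbTE (other_neq _)).
have EB := expectation_expR_hartigan P n d tau sigma mu xi z c i jb theta B
  tau0 sigma0 indX lawmu lawxi (cS jb).
have EA := expectation_expR_hartigan P n d tau sigma mu xi z c i j (- theta) A
  tau0 sigma0 indX lawmu lawxi (cS j) (fun=> Nj1).
rewrite /hartigan_weight jjb thB in EB.
rewrite /hartigan_weight eqxx thA in EA.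
have {}EB : (\int[P]_w (expR (theta * hartigan c (x w) i jb))%:E =
    ((Num.sqrt ((A + B) / (2 * A)))^-1 ^+ d)%:E)%E.
  by apply: EB => //; rewrite -subr_gt0 thB.
have {}EA : (\int[P]_w (expR (- theta * hartigan c (x w) i j))%:E =
    ((Num.sqrt ((A + B) / (2 * B)))^-1 ^+ d)%:E)%E.
  by apply: EA => //; rewrite -subr_gt0 thA.
have pow_gt0 (q : R) : 0 < q -> 0 < (Num.sqrt q)^-1 ^+ d.
  by move=> q0; rewrite exprn_gt0// invr_gt0 sqrtr_gt0.
have := chernoff_le P _ _ theta _ _ (mhartigan j) (mhartigan jb) theta0
  (pow_gt0 _ qA0) (pow_gt0 _ qB0) EB EA.
move=> /le_trans; apply; rewrite lee_fin.
rewrite -exprMn -invfM -(sqrtrM _ (ltW qA0)) -sqrtrV; last first.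
  by apply: mulr_ge0; exact: ltW.
rewrite (_ : (_ / _ * _)^-1 = rho); last first.
  by rewrite rhoE; field; rewrite !gt_eqF.
(* The exponent [d / 4] is [d] times two halves: one from the square root in the Gaussian
   transforms, one from the Chernoff bound. *)
rewrite -powR12_sqrt ?exprn_ge0 ?sqrtr_ge0// -(powR12_sqrt (ltW rho0)).
rewrite -powR_mulrn ?powR_ge0// (_ : d%:R / 4 = 2^-1 * d%:R * 2^-1); last by field.
by rewrite !powRrM.
Qed.
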